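(* Let $A=[S,D]\in\mathbb{R}^{m\times n}$ have full row rank, let $\Lambda=\mathrm{diag}(\Lambda_S,\Lambda_D)$ be a positive diagonal matrix, and let $F$ be an $m\times d$ matrix each of whose columns has exactly one nonzero entry, such that the Cholesky factorization $LL^T=S\Lambda_S S^T+FF^T$ is well-defined. Put $G=L^{-1}D\Lambda_D^{1/2}$ and $J=-L^{-1}F$. Then $W=I_m+GG^T-JJ^T$ is positive definite.
   Context: $A\in\mathbb{R}^{m\times n}$ has rank $m\le n$ and its columns are split as $A=[S,D]$ with $S\in\mathbb{R}^{m\times(n-k)}$ and $D\in\mathbb{R}^{m\times k}$; $\Lambda_S$ of size $(n-k)\times(n-k)$ and $\Lambda_D$ of size $k\times k$ are the corresponding diagonal blocks of the diagonal matrix $\Lambda$, all of whose diagonal entries are strictly positive. $F$ is $m\times d$ with $d\le k$. ''The Cholesky factorization of $S\Lambda_SS^T+FF^T$ is well-defined'' means this matrix is symmetric positive definite; $L$ is its lower triangular Cholesky factor with positive diagonal. *)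

(* Defs.v *)
From mathcomp Require Import all_boot all_order all_algebra.

Set Implicit Arguments.
Unset Strict Implicit.
Unset Printing Implicit Defensive.

Import Order.TTheory GRing.Theory Num.Theory.
Local Open Scope ring_scope.

Definition posdefmx (R : realDomainType) (m : nat) (M : 'M[R]_m) : Prop :=
  M^T = M /\ forall x : 'cV[R]_m, x != 0 -> 0 < (x^T *m M *m x) 0 0.

(* [is_trig_mx] is the library's lower triangular predicate. *)
Definition cholesky_factor (R : realDomainType) (m : nat) (M L : 'M[R]_m) : Prop :=
  [/\ is_trig_mx L, forall i, 0 < L i i & L *m L^T = M].

(* The entrywise square root; on a nonnegative diagonal matrix (the only use
   here) it is the principal square root, since [Num.sqrt 0 = 0]. *)
Definition sqrt_diag (R : rcfType) (k : nat) (M : 'M[R]_k) : 'M[R]_k :=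
  map_mx Num.sqrt M.

(* Main.v *)
(* Since [S *m LambdaS *m S^T = L *m L^T - F *m F^T], the matrix [W] equals
   [B *m Lambda *m B^T] with [B = L^-1 *m [S, D]]: the downdate by [J] only
   undoes the term [F *m F^T] that was added for the factorization. As [L] is
   invertible, [B] has full row rank, so [W] inherits positive definiteness
   from [Lambda]. *)
Require Import Defs.
From mathcomp Require Import all_boot all_order all_algebra.

Set Implicit Arguments.
Unset Strict Implicit.
Unset Printing Implicit Defensive.

Import Order.TTheory GRing.Theory Num.Theory.
Local Open Scope ring_scope.

(** With [y = B^T *m x], the quadratic form becomes a sum of squares of the entries of [y] with
    positive weights, and injectivity of [B^T] keeps [y] nonzero. *)
Lemma posdefmx_diag_conj (R : realDomainType) (m n : nat)
    (A : 'M[R]_n) (B : 'M[R]_(m, n)) :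
  is_diag_mx A -> (forall i, 0 < A i i) ->
  (forall x : 'cV[R]_m, x != 0 -> B^T *m x != 0) ->
  posdefmx (B *m A *m B^T).
Proof.
move=> /diag_mxP[a ->] a_gt0 injB; split.
  by rewrite !trmx_mul trmxK tr_diag_mx mulmxA.
move=> x /injB Btx_neq0.
have -> : x^T *m (B *m diag_mx a *m B^T) *m x =
    (B^T *m x)^T *m diag_mx a *m (B^T *m x).
  by rewrite trmx_mul trmxK !mulmxA.
move: (B^T *m x) Btx_neq0 => y y_neq0.
have -> : (y^T *m diag_mx a *m y) 0 0 = \sum_i a 0 i * y i 0 ^+ 2.
  rewrite mxE; apply: eq_bigr => i _.
  by rewrite mul_mx_diag !mxE mulrAC mulrC -expr2.
have a_pos i : 0 < a 0 i by have := a_gt0 i; rewrite mxE eqxx.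
have term_ge0 i : 0 <= a 0 i * y i 0 ^+ 2.
  by rewrite mulr_ge0 ?sqr_ge0 ?ltW.
(* If the sum of nonnegative terms were zero, every term would vanish, and the positive weights
   would force [y = 0]. *)
rewrite lt_neqAle sumr_ge0 // andbT eq_sym; apply: contra y_neq0.
move=> /eqP/psumr_eq0P sum0; apply/eqP/colP => i; rewrite mxE.
have /eqP := sum0 (fun i _ => term_ge0 i) i isT.
by rewrite mulf_eq0 gt_eqF //= sqrf_eq0 => /eqP.
Qed.

(** Serves to merge the two square roots inside [G *m G^T] into [LambdaD]. *)
Lemma sqrt_diag_mul_tr (R : rcfType) (k : nat) (A : 'M[R]_k) :
  is_diag_mx A -> (forall i, 0 <= A i i) ->
  sqrt_diag A *m (sqrt_diag A)^T = A.
Proof.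
move=> /diag_mxP[a ->] a_ge0.
have -> : sqrt_diag (diag_mx a) = diag_mx (map_mx Num.sqrt a).
  by apply/matrixP => i j; rewrite !mxE; case: eqP; rewrite ?mulr1n ?mulr0n ?sqrtr0.
rewrite tr_diag_mx mulmx_diag; congr diag_mx; apply/rowP => i.
by rewrite !mxE -expr2 sqr_sqrtr //; have := a_ge0 i; rewrite mxE eqxx.
Qed.

(** The determinant of a triangular matrix is the product of its diagonal entries, here all
    positive. *)
Lemma cholesky_factor_unitmx (R : realFieldType) (m : nat) (M L : 'M[R]_m) :
  cholesky_factor M L -> L \in unitmx.
Proof.
case=> L_trig L_gt0 _; rewrite unitmxE det_trig // unitfE.
by apply/prodf_neq0 => i _; rewrite gt_eqF.
Qed.

Theorem proposition4 (R : rcfType) (m p k d : nat)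
    (S : 'M[R]_(m, p)) (D : 'M[R]_(m, k)) (Lambda : 'M[R]_(p + k))
    (F : 'M[R]_(m, d)) (L : 'M[R]_m)
    (hmn : (m <= p + k)%N) (hdk : (d <= k)%N)
    (hA : \rank (row_mx S D) = m)
    (hdiag : is_diag_mx Lambda) (hpos : forall i, 0 < Lambda i i)
    (hF : forall j : 'I_d, #|[set i : 'I_m | F i j != 0]| = 1%N) :
  let LambdaS : 'M[R]_p := ulsubmx Lambda in
  let LambdaD : 'M[R]_k := drsubmx Lambda in
  let M : 'M[R]_m := S *m LambdaS *m S^T + F *m F^T in
  posdefmx M ->
  cholesky_factor M L ->
  let G : 'M[R]_(m, k) := invmx L *m D *m sqrt_diag LambdaD in
  let J : 'M[R]_(m, d) := - (invmx L *m F) in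
  let W : 'M[R]_m := 1%:M + G *m G^T - J *m J^T in
  posdefmx W.
Proof.
move=> LambdaS LambdaD M _ cholL G J W.
have Lunit := cholesky_factor_unitmx cholL; case: cholL => _ _ LLT.
set B := invmx L *m row_mx S D.
have eLambda : Lambda = block_mx LambdaS 0 0 LambdaD.
  have := hdiag; rewrite -{1}[Lambda]submxK is_diag_block_mx //.
  by case/and4P=> /eqP ur0 /eqP dl0 _ _; rewrite -{1}[Lambda]submxK ur0 dl0.
have LambdaD_diag : is_diag_mx LambdaD.
  by have := hdiag; rewrite eLambda is_diag_block_mx // => /and4P[].
have LambdaD_ge0 i : 0 <= LambdaD i i by rewrite !mxE ltW.
have eW : W = B *m Lambda *m B^T.
  (* Block by block, the left side is the [S] term plus the [D] term; the [S] term is [M], that is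
     [L *m L^T], minus [F *m F^T]. *)
  have eA : row_mx S D *m Lambda *m (row_mx S D)^T =
      L *m L^T - F *m F^T + D *m LambdaD *m D^T.
    rewrite LLT /M addrK eLambda mul_row_block !mulmx0 addr0 add0r.
    by rewrite tr_row_mx mul_row_col.
  have -> : B *m Lambda *m B^T =
      invmx L *m (row_mx S D *m Lambda *m (row_mx S D)^T) *m (invmx L)^T.
    by rewrite /B trmx_mul !mulmxA.
  (* Conjugation by [invmx L] turns [L *m L^T] into the identity; the sign in [J] cancels in
     [J *m J^T]. *)
  rewrite eA !(mulmxDr, mulmxDl) mulmxN mulNmx mulmxA mulVmx // mul1mx.
  rewrite -trmx_mul mulVmx // trmx1 /W /J linearN /= mulmxN mulNmx opprK.
  rewrite addrAC; congr (_ - _ + _); first by rewrite trmx_mul !mulmxA.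
  rewrite -[in RHS](sqrt_diag_mul_tr LambdaD_diag LambdaD_ge0).
  by rewrite /G !trmx_mul !mulmxA.
rewrite eW; apply: posdefmx_diag_conj => // x; apply: contra => /eqP Bx0.
(* Left multiplication by the invertible [invmx L] preserves the row space, so [B] has the rank [m]
   of [row_mx S D]. Transposing [B^T *m x = 0] then lets row freeness cancel [B]. *)
have Bfree : row_free B.
  by rewrite /row_free /B (eqmxMfull _ _) ?hA // row_full_unit unitmx_inv.
rewrite -trmx_eq0 -(mulmx_free_eq0 _ Bfree) -[B]trmxK -trmx_mul Bx0.
by rewrite trmx0.
Qed.
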